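(* For an $n$-node ring graph $\mathcal{G}_{\mathrm{r}}$ (cycle) with $n\ge 3$, let $\mathbf{W}_{\mathrm{r}}$ be the lazy ring matrix whose nonzero entries are $$[\mathbf{W}_{\mathrm{r}}]_{j,j}=\tfrac12,\qquad [\mathbf{W}_{\mathrm{r}}]_{j,j-1}=[\mathbf{W}_{\mathrm{r}}]_{j,j+1}=\tfrac14,$$ with indices taken modulo $n$. Then $\mathbf{W}_{\mathrm{r}}$ is nonnegative, symmetric, doubly stochastic, and positive semidefinite, its support graph is $\mathcal{G}_{\mathrm{r}}$, the graph diameter is $D_{\mathcal{G}_{\mathrm{r}}}=\lfloor n/2\rfloor$, and $$\lambda_{\mathbf{W}_{\mathrm{r}}}=\cos^2\left(\frac{\pi}{n}\right),\qquad \tau_{\mathbf{W}_{\mathrm{r}}}=\frac{1}{\sin^2(\pi/n)}=\Theta(n^2)=\Theta\left(D_{\mathcal{G}_{\mathrm{r}}}^2\right).$$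
   Context: The support graph of a symmetric nonnegative matrix has an edge $\{i,j\}$, $i\ne j$, exactly when its $(i,j)$ entry is positive. With $\mathbf{J}=\mathbf{1}\mathbf{1}^\top/n$ and $\|\cdot\|_2$ the spectral norm, $\lambda_{\mathbf{W}}:=\|\mathbf{W}-\mathbf{J}\|_2$ and $\tau_{\mathbf{W}}:=1/(1-\lambda_{\mathbf{W}})$ when $\lambda_{\mathbf{W}}<1$. $D_{\mathcal{G}}$ is the graph diameter. $\Theta$ is as $n\to\infty$ with universal constants. *)

(* Defs.v *)
From HB Require Import structures.
From mathcomp Require Import all_boot all_order all_algebra.
From mathcomp Require Import all_classical all_reals all_analysis.
From mathcomp Require Import sesquilinear.

Set Implicit Arguments.
Unset Strict Implicit.
Unset Printing Implicit Defensive.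

Import Order.TTheory GRing.Theory Num.Theory.
Import numFieldNormedType.Exports.

Local Open Scope classical_set_scope.
Local Open Scope ring_scope.

(* Finite simple graphs are given by their adjacency relation. *)

Section Graphs.
Local Open Scope nat_scope.

Definition has_walk (T : finType) (e : rel T) (x y : T) (k : nat) : bool :=
  [exists p : k.-tuple T, path e x p && (last x p == y)].

(* A shortest walk has length < #|T|, so [find] returns its length when y is
   reachable from x. Otherwise it returns #|T|, larger than any distance between
   connected vertices; hence [diameter e < #|T|] forces [e] to be connected
   (for nonempty T). *)
Definition graph_dist (T : finType) (e : rel T) (x y : T) : nat :=
  find (has_walk e x y) (iota 0 #|T|).

Definition diameter (T : finType) (e : rel T) : nat :=
  \max_(x : T) \max_(y : T) graph_dist e x y.

(* Meant for 3 <= n; [ordS i] is i + 1 modulo n. *)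
Definition ring_graph (n : nat) : rel 'I_n :=
  [rel i j | (j == ordS i) || (i == ordS j)].

End Graphs.

Definition support_graph (R : realType) (n : nat) (W : 'M[R]_n) : rel 'I_n :=
  [rel i j | (i != j) && (0 < W i j)].

Definition nonneg_mx (R : realType) (n : nat) (W : 'M[R]_n) : Prop :=
  forall i j, 0 <= W i j.

Definition doubly_stochastic (R : realType) (n : nat) (W : 'M[R]_n) : Prop :=
  [/\ nonneg_mx W,
      forall i, \sum_j W i j = 1 &
      forall j, \sum_i W i j = 1].

Definition pos_semidef (R : realType) (n : nat) (W : 'M[R]_n) : Prop :=
  W \is symmetricmx /\ forall x : 'cV[R]_n, 0 <= (x^T *m W *m x) 0 0.

(* The library norm [`|x|] on matrices is the maximum norm, whence these. *)
Definition norm2 (R : realType) (n : nat) (x : 'cV[R]_n) : R :=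
  Num.sqrt (\sum_i x i 0 ^+ 2).

Definition spectral_norm (R : realType) (n : nat) (A : 'M[R]_n) : R :=
  sup [set norm2 (A *m x) | x in [set x : 'cV[R]_n | norm2 x <= 1]].

Definition avg_mx (R : realType) (n : nat) : 'M[R]_n :=
  n%:R^-1 *: ((const_mx 1 : 'cV[R]_n) *m (const_mx 1 : 'cV[R]_n)^T).

Definition lambda_mx (R : realType) (n : nat) (W : 'M[R]_n) : R :=
  spectral_norm (W - avg_mx R n).

(* Only meaningful when [lambda_mx W < 1]. *)
Definition tau_mx (R : realType) (n : nat) (W : 'M[R]_n) : R :=
  1 / (1 - lambda_mx W).

Definition lazy_ring (R : realType) (n : nat) : 'M[R]_n :=
  \matrix_(i, j)
    if j == i then 1 / 2
    else if (j == ord_pred i) || (j == ordS i) then 1 / 4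
    else 0.

(* Main.v *)
Require Import Defs.
From HB Require Import structures.
From mathcomp Require Import all_boot all_order all_algebra.
From mathcomp Require Import all_classical all_reals all_analysis.
From mathcomp Require Import sesquilinear.
From mathcomp Require Import zify ring lra.

Import Order.TTheory GRing.Theory Num.Theory.
Import numFieldNormedType.Exports.

Local Open Scope classical_set_scope.
Local Open Scope ring_scope.

(** The matrix W = lazy_ring R n is circulant, so the discrete Fourier modes
    j |-> cos (2 pi k j / n + phi) diagonalize it; the real phase phi covers
    cosines and sines together.  By the addition formulas mode k has the
    eigenvalue 1/2 + cos (2 pi k / n) / 2 = cos^2 (pi k / n)
    ([lazy_ring_wave]).  The averaging matrix J kills the modes 0 < k < n and
    agrees with W on the constant mode, so W - J has eigenvalue 0 on mode 0
    and cos^2 (pi k / n) on the others ([deviation_wave0], [deviation_wave]).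
    The largest of these is reached at k = 1 ([cos2_pi_frac_le]).

    To turn eigenvalues into an operator norm, Parseval's identity
    ([wave_parseval]) writes the squared Euclidean norm of a vector as a sum of
    squares of its Fourier coefficients; each coefficient of (W - J) x is an
    eigenvalue times the coefficient of x, hence (W - J) contracts by
    cos^2 (pi / n), and mode 1 shows that the bound is attained
    ([spectral_norm_eq]).  Parseval rests on the vanishing of the sums of
    cos (2 k pi m / n) over k < n, which telescope after multiplication by
    2 sin (pi m / n) ([sum_cos_multiples]).

    Positive semidefiniteness is a sum of squares: x^T W x is a quarter of the
    sum of the (x_j + x_(j+1))^2.

    For the diameter, walking around the cycle in the shorter direction joins
    any two vertices in at most n / 2 steps, while i |-> min (i, n - i) changes
    by at most 1 along an edge and goes from 0 to n / 2 between the vertices 0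
    and n / 2.

    Finally x cos x <= sin x <= x, applied at x = pi / n <= pi / 3, squeezes
    1 / sin^2 (pi / n) between two constant multiples of n^2. *)

(** * Walks and distances in finite graphs *)

Section Walks.
Local Open Scope nat_scope.
Context {T : finType} {e : rel T}.

Lemma has_walk_iter (f : T -> T) (x : T) (k : nat) :
  (forall z, e z (f z)) -> has_walk e x (iter k f x) k.
Proof.
move=> ef; have sz : size (traject f (f x) k) == k by rewrite size_traject.
apply/existsP; exists (Tuple sz) => /=; rewrite last_traject eqxx andbT.
by apply: sub_path (fpath_traject f x k) => u v /= /eqP <-.
Qed.

Lemma graph_dist_le {x y : T} {k : nat} :
  has_walk e x y k -> graph_dist e x y <= k.
Proof.
move=> wk; rewrite /graph_dist leqNgt; apply/negP => lt_k.
have := before_find 0 lt_k; rewrite nth_iota ?add0n ?wk//.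
by rewrite (leq_trans lt_k)// -[leqRHS](size_iota 0) find_size.
Qed.

(** The bound [m <= #|T|] matters because [graph_dist] takes the value #|T| when
    there is no walk at all. *)
Lemma graph_dist_ge (x y : T) (m : nat) : m <= #|T| ->
  (forall k, has_walk e x y k -> m <= k) -> m <= graph_dist e x y.
Proof.
move=> leT walk_ge; rewrite leqNgt; apply/negP => lt_m.
have ltT : graph_dist e x y < #|T| by apply: leq_trans leT.
have hasT : has (has_walk e x y) (iota 0 #|T|) by rewrite has_find size_iota.
have := nth_find 0 hasT; rewrite nth_iota// add0n => /walk_ge.
by rewrite leqNgt lt_m.
Qed.

(** Lower bounds on walk lengths come from a function that grows by at most 1
    along each edge: its increment bounds the length from below. *)
Lemma has_walk_lipschitz (d : T -> nat) {x y : T} {k : nat} :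
  (forall u v, e u v -> d v <= (d u).+1) ->
  has_walk e x y k -> d y <= d x + k.
Proof.
move=> de /existsP[[p /= /eqP <-]] /andP[] + /eqP <-.
elim: p x => [|z p IHp] x /=; first by rewrite addn0.
by case/andP => /de dz /IHp; lia.
Qed.

End Walks.

(** * The diameter of the cycle *)

Section RingDiameter.
Local Open Scope nat_scope.
Context {n : nat}.

Lemma eq_ord_pred (i j : 'I_n) : (j == ord_pred i) = (i == ordS j).
Proof. by rewrite -(inj_eq (@ordS_inj n)) ord_predK eq_sym. Qed.

Lemma val_iter_ordS (i : 'I_n) (k : nat) : iter k (@ordS n) i = (i + k) %% n :> nat.
Proof.
elim: k => [|k IHk] /=; first by rewrite addn0 modn_small.
by rewrite IHk addnS -addn1 modnDml addn1.
Qed.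

Lemma iter_ordS_ord_pred (i j : 'I_n) (k : nat) :
  iter k (@ordS n) i = j -> iter k (@ord_pred n) j = i.
Proof.
by move=> <-; elim: k => //= k IHk; rewrite -iterS iterSr /= ordSK.
Qed.

(** One of the two arcs from x to y, of lengths k and n - k, has length at most
    n / 2. *)
Lemma ring_dist_le (x y : 'I_n) : graph_dist (@ring_graph n) x y <= n %/ 2.
Proof.
have [ltx lty] := (ltn_ord x, ltn_ord y).
(* k is the length of the increasing arc from x to y; with x = y it is 0. *)
have [k [le_kn xk yk]] : exists k,
    [/\ k <= n, (x + k) %% n = y & (y + (n - k)) %% n = x].
  have [le_xy|lt_yx] := leqP x y.
    exists (y - x); split; [lia|by rewrite subnKC// modn_small|].
    by rewrite (_ : y + _ = x + n) ?modnDr ?modn_small//; lia.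
  exists (n - (x - y)); split; [lia| |].
    by rewrite (_ : x + _ = y + n) ?modnDr ?modn_small//; lia.
  by rewrite (_ : y + _ = x) ?modn_small//; lia.
have [le_k|gt_k] := leqP k (n %/ 2).
  apply: leq_trans (graph_dist_le _) le_k.
  have <- : iter k (@ordS n) x = y by apply: val_inj; rewrite /= val_iter_ordS.
  by apply: has_walk_iter => z; rewrite /ring_graph /= eqxx.
have le_nk : n - k <= n %/ 2 by lia.
apply: leq_trans (graph_dist_le _) le_nk.
have <- : iter (n - k) (@ord_pred n) x = y.
  by apply: iter_ordS_ord_pred; apply: val_inj; rewrite /= val_iter_ordS.
by apply: has_walk_iter => z; rewrite /ring_graph /= ord_predK eqxx orbT.
Qed.

Lemma ring_dist_ge (n_gt0 : 0 < n) (lt_half : n %/ 2 < n) :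
  n %/ 2 <= graph_dist (@ring_graph n) (Ordinal n_gt0) (Ordinal lt_half).
Proof.
(* d is the distance to vertex 0. *)
pose d (i : 'I_n) := minn i (n - i).
have dS (i : 'I_n) : d (ordS i) <= (d i).+1 /\ d i <= (d (ordS i)).+1.
  have lti := ltn_ord i; rewrite /d /=.
  move: lti; rewrite leq_eqVlt => /predU1P[Si|lti]; first by rewrite Si modnn; lia.
  by rewrite modn_small//; lia.
apply: graph_dist_ge => [|k wk]; first by rewrite card_ord ltnW.
suff : d (Ordinal lt_half) <= d (Ordinal n_gt0) + k by rewrite /d /=; lia.
apply: has_walk_lipschitz wk => u v.
by case/orP => /eqP ->; [have [] := dS u | have [] := dS v].
Qed.

Lemma diameter_ring : 0 < n -> diameter (@ring_graph n) = n %/ 2.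
Proof.
move=> n_gt0; have lt_half : n %/ 2 < n by lia.
apply/eqP; rewrite eqn_leq; apply/andP; split.
  apply/bigmax_leqP => x _; apply/bigmax_leqP => y _; exact: ring_dist_le.
apply: leq_trans (ring_dist_ge n_gt0 lt_half) _.
apply: leq_trans (leq_bigmax (Ordinal n_gt0)).
exact: (leq_bigmax (Ordinal lt_half)).
Qed.

End RingDiameter.

(** * Spectral norms and the dot product *)

Section SpectralNorm.
Context {R : realType} {n : nat}.
Implicit Types (A : 'M[R]_n) (x v : 'cV[R]_n).

Lemma norm2Z (a : R) x : norm2 (a *: x) = `|a| * norm2 x.
Proof.
rewrite /norm2 -sqrtr_sqr -sqrtrM ?sqr_ge0//; congr Num.sqrt.
by rewrite mulr_sumr; apply: eq_bigr => i _; rewrite mxE exprMn.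
Qed.

Lemma norm2_gt0 x : x != 0 -> 0 < norm2 x.
Proof.
move=> x_neq0; have [i xi] : exists i, x i 0 != 0.
  apply: contrapT => noi; case/negP: x_neq0; apply/eqP/colP => i; rewrite mxE.
  by apply: contrapT => xi; apply: noi; exists i; apply/eqP.
rewrite sqrtr_gt0 (bigD1 i)//= ltr_pwDl ?sumr_ge0// => [|j _]; last exact: sqr_ge0.
by rewrite exprn_even_gt0.
Qed.

(** An eigenvector attains the supremum, so a contraction bound that matches an
    eigenvalue is sharp; squares avoid carrying square roots in the bound. *)
Lemma spectral_norm_eq A v (c : R) : 0 <= c -> v != 0 -> A *m v = c *: v ->
  (forall x, \sum_i ((A *m x) i 0) ^+ 2 <= c ^+ 2 * \sum_i x i 0 ^+ 2) ->
  spectral_norm A = c.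
Proof.
move=> c_ge0 v_neq0 Avcv bound.
have leA x : norm2 x <= 1 -> norm2 (A *m x) <= c.
  move=> x_le1; apply: (@le_trans _ _ (c * norm2 x)); last by rewrite ler_piMr.
  by rewrite -[c in leRHS]ger0_norm// -sqrtr_sqr -sqrtrM ?sqr_ge0// ler_wsqrtr.
have v_gt0 := norm2_gt0 _ v_neq0.
have u1 : norm2 ((norm2 v)^-1 *: v) = 1.
  by rewrite norm2Z ger0_norm ?invr_ge0 ?ltW// mulVf// gt_eqF.
have Au : norm2 (A *m ((norm2 v)^-1 *: v)) = c.
  by rewrite -scalemxAr Avcv scalerA mulrC -scalerA norm2Z u1 mulr1 ger0_norm.
apply/le_anti/andP; split.
  apply: ge_sup; first by exists c; exists ((norm2 v)^-1 *: v); rewrite //= u1.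
  by move=> _ [x /= x_le1 <-]; exact: leA.
apply: ub_le_sup; first by exists c => _ [x /= x_le1 <-]; exact: leA.
by exists ((norm2 v)^-1 *: v); rewrite //= u1.
Qed.

End SpectralNorm.

Definition dot {R : realType} {n : nat} (x y : 'cV[R]_n) : R :=
  \sum_i x i 0 * y i 0.

Lemma dot_mulmx_sym {R : realType} {n : nat} (A : 'M[R]_n) (x y : 'cV[R]_n) :
  A^T = A -> dot (A *m x) y = dot x (A *m y).
Proof.
move=> symA; rewrite /dot.
under eq_bigr do rewrite mxE mulr_suml.
under [RHS]eq_bigr do rewrite mxE mulr_sumr.
rewrite exchange_big; apply: eq_bigr => j _; apply: eq_bigr => i _ /=.
by rewrite -[in RHS]symA [in RHS]mxE; ring.
Qed.

Lemma dotZr {R : realType} {n : nat} (a : R) (x y : 'cV[R]_n) :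
  dot x (a *: y) = a * dot x y.
Proof. by rewrite /dot mulr_sumr; apply: eq_bigr => i _; rewrite mxE mulrCA. Qed.

(** * The lazy ring matrix *)

Section Ring.
Context {R : realType} {n : nat}.
Context (n_ge3 : (3 <= n)%N).
Local Notation W := (lazy_ring R n).

Lemma ordS_neq (i : 'I_n) : ordS i != i.
Proof.
have lti := ltn_ord i.
rewrite -val_eqE /=; move: lti; rewrite leq_eqVlt => /predU1P[Si|lti].
  by rewrite Si modnn; lia.
by rewrite modn_small//; lia.
Qed.

(** For n >= 3 the three indices i, i - 1 and i + 1 are distinct, so the nested
    tests in the definition become a sum of indicators, which is linear and
    hence convenient for matrix products. *)
Lemma lazy_ringE i j : W i j =
  (i == j)%:R / 2 + (ord_pred i == j)%:R / 4 + (ordS i == j)%:R / 4.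
Proof.
have lti := ltn_ord i.
have Si := ordS_neq i.
have SSi : ordS (ordS i) != i.
  rewrite -val_eqE /=; move: lti; rewrite leq_eqVlt => /predU1P[Si'|lti'].
    by rewrite Si' modnn modn_small//; lia.
  rewrite (modn_small lti'); move: lti'; rewrite leq_eqVlt => /predU1P[Si'|lti'].
    by rewrite Si' modnn; lia.
  by rewrite modn_small//; lia.
have Pi : ord_pred i != i by rewrite -(inj_eq (@ordS_inj n)) ord_predK eq_sym.
have PSi : ord_pred i != ordS i.
  by rewrite -(inj_eq (@ordS_inj n)) ord_predK eq_sym.
rewrite mxE ![_ == j]eq_sym.
have [->|ji] := eqVneq j i.
  by rewrite ![i == _]eq_sym (negbTE Pi) (negbTE Si) !mul0r !addr0.
rewrite mul0r add0r.
have [->|jp] := eqVneq j (ord_pred i); first by rewrite (negbTE PSi) mul0r addr0.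
by rewrite mul0r add0r; case: eqP => _; rewrite ?mul0r.
Qed.

Lemma lazy_ring_mulE (x : 'cV[R]_n) i : (W *m x) i 0 =
  x i 0 / 2 + (x (ordS i) 0 + x (ord_pred i) 0) / 4.
Proof.
have delta (k : 'I_n) (a : R) : \sum_j (k == j)%:R / a * x j 0 = x k 0 / a.
  rewrite (bigD1 k)//= big1 ?addr0 ?eqxx; last first.
    by move=> j /negbTE; rewrite eq_sym => ->; rewrite !mul0r.
  by rewrite mul1r mulrC.
rewrite mxE; under eq_bigr do rewrite lazy_ringE !mulrDl.
rewrite !big_split /= !delta; ring.
Qed.

Lemma lazy_ring_ge0 : nonneg_mx W.
Proof. by move=> i j; rewrite lazy_ringE !addr_ge0 ?divr_ge0. Qed.

Lemma lazy_ring_tr : W^T = W.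
Proof.
apply/matrixP => i j; rewrite mxE !lazy_ringE.
rewrite [j == i]eq_sym.
rewrite [ord_pred j == i]eq_sym eq_ord_pred.
rewrite [ord_pred i == j]eq_sym eq_ord_pred.
rewrite [j == ordS i]eq_sym [i == ordS j]eq_sym.
ring.
Qed.

Lemma lazy_ring_sym : W \is symmetricmx.
Proof.
apply/is_hermitianmxP; rewrite expr0 scale1r.
by apply/matrixP => i j; rewrite -[in LHS]lazy_ring_tr !mxE.
Qed.

(** The row sums are the entries of W applied to the constant vector 1. *)
Lemma lazy_ring_row i : \sum_j W i j = 1.
Proof.
transitivity ((W *m const_mx 1 : 'cV_n) i 0).
  by rewrite mxE; apply: eq_bigr => j _; rewrite [const_mx _ _ _]mxE mulr1.
by rewrite lazy_ring_mulE !mxE; field.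
Qed.

Lemma lazy_ring_col j : \sum_i W i j = 1.
Proof.
rewrite -[RHS](lazy_ring_row j); apply: eq_bigr => i _.
by rewrite -[in RHS]lazy_ring_tr [RHS]mxE.
Qed.

(** Half of the diagonal term goes to each of the edges at j, which completes the
    squares: x^T W x = 1/4 * sum_j (x_j + x_(j+1))^2. *)
Lemma lazy_ring_psd : pos_semidef W.
Proof.
split=> [|x]; first exact: lazy_ring_sym.
rewrite -mulmxA mxE.
suff -> : \sum_j x^T 0 j * (W *m x) j 0 =
    4^-1 * \sum_j (x j 0 + x (ordS j) 0) ^+ 2.
  by rewrite mulr_ge0 ?sumr_ge0 // => j _; exact: sqr_ge0.
have sumS (F : 'I_n -> R) : \sum_j F (ordS j) = \sum_j F j.
  by rewrite [RHS](reindex_inj (@ordS_inj n)).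
transitivity (\sum_j (x j 0 ^+ 2 / 2 + x j 0 * x (ordS j) 0 / 4)
   + \sum_j x j 0 * x (ord_pred j) 0 / 4).
  rewrite -big_split /=; apply: eq_bigr => j _.
  by rewrite lazy_ring_mulE mxE; ring.
rewrite -[X in _ + X]sumS; under [X in _ + X]eq_bigr do rewrite ordSK.
rewrite -big_split /= mulr_sumr.
(* The second half of the squares is shifted by one vertex. *)
transitivity (\sum_j (x j 0 ^+ 2 / 4 + x j 0 * x (ordS j) 0 / 2)
   + \sum_j x j 0 ^+ 2 / 4).
  by rewrite -big_split /=; apply: eq_bigr => j _; field.
rewrite -[X in _ + X]sumS -big_split /=.
by apply: eq_bigr => j _; field.
Qed.

Lemma lazy_ring_support : support_graph W =2 @ring_graph n.
Proof.
move=> i j; rewrite /support_graph /ring_graph /=.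
rewrite lazy_ringE [ord_pred i == j]eq_sym eq_ord_pred [j == _]eq_sym.
have [<-|ij] /= := eqVneq i j.
  by rewrite [i == _]eq_sym (negbTE (ordS_neq i)).
rewrite mul0r add0r orbC.
by do 2!case: eqP => _ /=; rewrite ?mul0r ?addr0 ?add0r ?ltxx// ?addr_gt0 ?divr_gt0.
Qed.

End Ring.

(** * Trigonometric sums and estimates *)

Section Trig.
Context {R : realType}.
Implicit Types (a b x : R) (k n : nat).

Lemma cos2piD k a : cos (a + pi *+ 2 * k%:R) = cos a.
Proof. by rewrite mulr_natr (periodicn (@cosD2pi R)). Qed.

Lemma sin2piD k a : sin (a + pi *+ 2 * k%:R) = sin a.
Proof. by rewrite mulr_natr (periodicn (@sinD2pi R)). Qed.

(** 2 sin b cos (2 k b) = sin ((2 k + 1) b) - sin ((2 k - 1) b). *)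
Lemma sum_cos_telescope b n :
  2 * sin b * (\sum_(k < n) cos (2 * k%:R * b)) = sin ((2 * n%:R - 1) * b) + sin b.
Proof.
rewrite mulr_sumr -(big_mkord xpredT (fun k => 2 * sin b * cos (2 * k%:R * b))).
transitivity (\sum_(0 <= k < n)
    (sin ((2 * k.+1%:R - 1) * b) - sin ((2 * k%:R - 1) * b))).
  apply: eq_bigr => k _.
  have -> : (2 * k.+1%:R - 1) * b = 2 * k%:R * b + b by rewrite -natr1; ring.
  have -> : (2 * k%:R - 1) * b = 2 * k%:R * b - b by ring.
  by rewrite sinD sinB; ring.
rewrite telescope_sumr//; congr (_ + _).
by rewrite mulr0 sub0r mulN1r sinN opprK.
Qed.

Lemma sin_pi_frac_gt0 {m n} : (0 < m < n)%N -> 0 < sin (pi * m%:R / n%:R) :> R.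
Proof.
move=> /andP[m_gt0 lt_mn]; apply: sin_gt0_pi.
have n_gt0 : 0 < n%:R :> R by rewrite ltr0n (leq_ltn_trans _ lt_mn).
apply/andP; split; first by rewrite divr_gt0 // mulr_gt0 ?pi_gt0 ?ltr0n.
by rewrite ltr_pdivrMr// ltr_pM2l ?pi_gt0// ltr_nat.
Qed.

(** For b = pi m / n the two boundary terms of the telescoping sum cancel, since
    (2 n - 1) b differs from - b by a multiple of 2 pi, and sin b is nonzero. *)
Lemma sum_cos_multiples {m n} : (0 < m < n)%N ->
  \sum_(k < n) cos (2 * k%:R * (pi * m%:R / n%:R)) = 0 :> R.
Proof.
move=> mn; have s_gt0 := sin_pi_frac_gt0 mn.
have n_neq0 : n%:R != 0 :> R by rewrite pnatr_eq0; lia.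
have := sum_cos_telescope (pi * m%:R / n%:R) n.
have -> : (2 * n%:R - 1) * (pi * m%:R / n%:R) =
    - (pi * m%:R / n%:R) + pi *+ 2 * m%:R :> R by field.
rewrite sin2piD sinN addNr => /eqP; rewrite !mulf_eq0.
by rewrite pnatr_eq0 (gt_eqF s_gt0) => /eqP.
Qed.

(** For 0 < m < n the angle pi m / n lies between pi / n and pi - pi / n, and cos
    decreases from cos (pi / n) to - cos (pi / n) on that interval. *)
Lemma cos2_pi_frac_le {m n} : (0 < m < n)%N ->
  cos (pi * m%:R / n%:R) ^+ 2 <= cos (pi / n%:R) ^+ 2 :> R.
Proof.
move=> /andP[m_gt0 lt_mn].
have n_gt0 : 0 < n%:R :> R by rewrite ltr0n (leq_ltn_trans _ lt_mn).
have n_neq0 := lt0r_neq0 n_gt0; have pi0 := @pi_gt0 R.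
have m1 : 1 <= m%:R :> R by rewrite ler1n.
have mn : m%:R + 1 <= n%:R :> R by rewrite natr1 ler_nat.
set a := pi / n%:R; have an : a * n%:R = pi by rewrite /a divfK.
have -> : pi * m%:R / n%:R = a * m%:R by rewrite /a mulrAC.
have a_gt0 : 0 < a by rewrite divr_gt0.
have ler_cos x y : 0 <= x -> x <= y -> y <= pi -> cos y <= cos x :> R.
  move=> x0 xy ypi; rewrite leNgt ltr_cos ?in_itv /= -?leNgt//; lra.
have le_am : a <= a * m%:R by rewrite ler_peMr // ltW.
have le_ma : a * m%:R + a <= pi by rewrite -an -[X in _ + X]mulr1 -mulrDr ler_pM2l.
have cosa_ge0 : 0 <= cos a by apply: cos_ge0_pihalf; lra.
have cosBpi : cos (pi - a) = - cos a by rewrite addrC cosDpi cosN.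
rewrite -[leLHS]real_normK ?num_real// -[leRHS]real_normK ?num_real//.
rewrite ler_sqr ?nnegrE// [leRHS]ger0_norm// ler_norml -cosBpi.
by rewrite !ler_cos//; lra.
Qed.

(** By the mean value theorem sin x = x cos c for some c in ]0, x[. *)
Lemma sin_bounds x : 0 < x < pi / 2 -> x * cos x <= sin x <= x.
Proof.
move=> /andP[x_gt0 x_lt].
have [c] := @MVT _ sin cos 0 x x_gt0 (fun _ _ => is_derive_sin _)
  (continuous_subspaceT (@continuous_sin R)).
rewrite in_itv /= sin0 !subr0 => /andP[c_gt0 c_lt] ->.
have pi0 := @pi_gt0 R.
rewrite (ler_piMl (ltW x_gt0) (cos_le1 c)) andbT mulrC ler_pM2r//.
rewrite leNgt ltr_cos ?in_itv /= -?leNgt//; lra.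
Qed.

End Trig.

(** * Real discrete Fourier analysis *)

Section Fourier.
Context {R : realType} {n : nat}.
Implicit Types (x : 'cV[R]_n) (phi : R) (k : nat).

(** The phase lets one family stand for all the real Fourier modes of frequency
    k: phi = 0 gives the cosine and phi = pi / 2 the opposite of the sine. *)
Definition wave k phi : 'cV[R]_n :=
  \col_(j < n) cos (2 * k%:R * (pi * j%:R / n%:R) + phi).

Lemma sum_cos_diff (i j : 'I_n) :
  \sum_(k < n) cos (2 * k%:R * (pi * i%:R / n%:R) - 2 * k%:R * (pi * j%:R / n%:R))
  = n%:R * (i == j)%:R :> R.
Proof.
wlog le_ji : i j / (j <= i)%N => [H|].
  have [/H //|/ltnW/H H_ji] := leqP j i; rewrite eq_sym -H_ji.
  by apply: eq_bigr => k _; rewrite -cosN opprB.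
have [->|ij] := eqVneq i j.
  by rewrite mulr1; under eq_bigr do rewrite subrr cos0; rewrite sumr_const card_ord.
have ij_n : (0 < i - j < n)%N.
  by rewrite subn_gt0 ltn_neqAle eq_sym ij le_ji (leq_ltn_trans (leq_subr _ _)).
rewrite mulr0 -[RHS](sum_cos_multiples ij_n).
by apply: eq_bigr => k _; rewrite natrB//; congr cos; ring.
Qed.

(** Expanding the squares, the coefficient of x_i x_j is the sum over k of
    cos (2 pi k (i - j) / n), which vanishes unless i = j.  Frequencies k and
    n - k contribute equally; letting k run over all of 'I_n spares the frequencies
    0 and n / 2, which are their own partners, a separate normalization. *)
Lemma wave_parseval x :
  \sum_(k < n) (dot x (wave k 0) ^+ 2 + dot x (wave k (pi / 2)) ^+ 2) =
  n%:R * \sum_i x i 0 ^+ 2.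
Proof.
have expand (k : 'I_n) : dot x (wave k 0) ^+ 2 + dot x (wave k (pi / 2)) ^+ 2 =
  \sum_i \sum_j x i 0 * x j 0 *
    cos (2 * k%:R * (pi * i%:R / n%:R) - 2 * k%:R * (pi * j%:R / n%:R)).
  rewrite /dot !expr2 !big_distrlr -big_split /=; apply: eq_bigr => i _.
  rewrite -big_split /=; apply: eq_bigr => j _.
  by rewrite !mxE !addr0 !cosDpihalf cosB; ring.
under eq_bigr do rewrite expand.
rewrite exchange_big mulr_sumr; apply: eq_bigr => i _ /=.
rewrite exchange_big /= (bigD1 i)//= [X in _ + X]big1 => [|j ji].
  by rewrite -mulr_sumr sum_cos_diff eqxx mulr1 addr0; ring.
by rewrite -mulr_sumr sum_cos_diff eq_sym (negbTE ji) !mulr0.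
Qed.

End Fourier.

(** * The spectrum of the deviation from the average *)

Section Spectrum.
Context {R : realType} {n : nat}.
Context (n_ge3 : (3 <= n)%N).
Implicit Types (x : 'cV[R]_n) (phi : R) (k : nat).
Local Notation W := (lazy_ring R n).
Local Notation J := (avg_mx R n).
Local Notation wave := (@wave R n).

Let n_gt0 : 0 < n%:R :> R. Proof. rewrite ltr0n; lia. Qed.
Let n_neq0 : n%:R != 0 :> R. Proof. exact: lt0r_neq0. Qed.

(** The modes are n-periodic in the vertex index; this removes the reduction
    modulo n hidden in [ordS] and [ord_pred]. *)
Lemma cos_wave_modn k phi (m : nat) :
  cos (2 * k%:R * (pi * (m %% n)%:R / n%:R) + phi) =
  cos (2 * k%:R * (pi * m%:R / n%:R) + phi).
Proof.
rewrite {2}(divn_eq m n) -[LHS](cos2piD (k * (m %/ n))).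
by congr cos; rewrite natrD !natrM; field.
Qed.

(** With b = pi k / n, cos (t + 2 b) + cos (t - 2 b) = 2 cos t cos (2 b) and
    cos (2 b) = 2 cos^2 b - 1. *)
Lemma lazy_ring_wave k phi :
  W *m wave k phi = cos (pi * k%:R / n%:R) ^+ 2 *: wave k phi.
Proof.
apply/colP => i; rewrite lazy_ring_mulE// !mxE /= !cos_wave_modn.
set t := 2 * k%:R * (pi * i%:R / n%:R) + phi.
set b := pi * k%:R / n%:R.
have -> : 2 * k%:R * (pi * i.+1%:R / n%:R) + phi = t + b *+ 2.
  by rewrite /t /b -natr1; field.
have -> : 2 * k%:R * (pi * (i + n).-1%:R / n%:R) + phi = t - b *+ 2 + pi *+ 2 * k%:R.
  have -> : (i + n).-1%:R = i%:R + n%:R - 1 :> R.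
    by rewrite -natrD -[in RHS](prednK (n := (i + n))) -?natr1 ?addrK//; lia.
  by rewrite /t /b; field.
by rewrite cos2piD cosB (cosD t (b *+ 2)) cos_mulr2n; field.
Qed.

Lemma avg_mx_mulE x i : (J *m x) i 0 = n%:R^-1 * \sum_j x j 0.
Proof.
rewrite -scalemxAl mxE; congr (_ * _); rewrite mxE.
by apply: eq_bigr => j _; rewrite mxE big_ord1 !mxE !mul1r.
Qed.

Lemma avg_mx_tr : J^T = J.
Proof. by rewrite /avg_mx linearZ /= trmx_mul trmxK. Qed.

Lemma cos2_lt1 k : (0 < k < n)%N -> cos (pi * k%:R / n%:R) ^+ 2 < 1 :> R.
Proof. by move=> kn; rewrite cos2sin2 ltrBlDr ltrDl exprn_gt0 ?sin_pi_frac_gt0. Qed.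

(** W is symmetric and fixes the constant vector. *)
Lemma sum_mul_lazy x : \sum_i (W *m x) i 0 = \sum_i x i 0.
Proof.
have dot1 (y : 'cV[R]_n) : \sum_i y i 0 = dot y (const_mx 1) :> R.
  by apply: eq_bigr => i _; rewrite mxE mulr1.
rewrite !dot1 dot_mulmx_sym ?lazy_ring_tr//; congr dot.
by apply/colP => i; rewrite lazy_ring_mulE// !mxE; field.
Qed.

(** W preserves the sum of the entries but multiplies that of a mode 0 < k < n by
    its eigenvalue, which is less than 1; so this sum is zero. *)
Lemma avg_mx_wave k phi : (0 < k < n)%N -> J *m wave k phi = 0.
Proof.
move=> kn; apply/colP => i; rewrite avg_mx_mulE mxE.
have := sum_mul_lazy (wave k phi); rewrite lazy_ring_wave.
under eq_bigr do rewrite mxE.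
rewrite -mulr_sumr => /eqP; rewrite -subr_eq0 -{2}[\sum_i _]mul1r -mulrBl.
rewrite mulf_eq0 subr_eq0 (lt_eqF (cos2_lt1 _ kn)) => /eqP ->.
by rewrite mulr0.
Qed.

Lemma deviation_wave k phi : (0 < k < n)%N ->
  (W - J) *m wave k phi = cos (pi * k%:R / n%:R) ^+ 2 *: wave k phi.
Proof. by move=> kn; rewrite mulmxBl avg_mx_wave// subr0 lazy_ring_wave. Qed.

Lemma deviation_wave0 phi : (W - J) *m wave 0 phi = 0.
Proof.
rewrite mulmxBl lazy_ring_wave mulr0 mul0r cos0 expr1n scale1r.
apply/colP => i; rewrite mxE [(- (J *m _)) _ _]mxE avg_mx_mulE !mxE.
under eq_bigr do rewrite mxE mulr0 mul0r add0r.
by rewrite sumr_const card_ord mulr0 mul0r add0r -(mulr_natl (cos phi)) mulKf ?subrr.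
Qed.

(** By symmetry of W - J, the Fourier coefficients of (W - J) x are those of x
    times the eigenvalues, so the bound holds coefficient by coefficient. *)
Lemma deviation_contracts x :
  \sum_i ((W - J) *m x) i 0 ^+ 2 <=
  (cos (pi / n%:R) ^+ 2) ^+ 2 * \sum_i x i 0 ^+ 2.
Proof.
have trWJ : (W - J)^T = W - J by rewrite linearB /= lazy_ring_tr// avg_mx_tr.
rewrite -(ler_pM2l n_gt0) mulrCA -!wave_parseval mulr_sumr.
have coef (k : 'I_n) phi : dot ((W - J) *m x) (wave k phi) ^+ 2 <=
    (cos (pi / n%:R) ^+ 2) ^+ 2 * dot x (wave k phi) ^+ 2.
  rewrite dot_mulmx_sym//; have [k0|k0] := posnP k.
    rewrite k0 deviation_wave0 -(scale0r (wave 0 phi)) dotZr mul0r expr0n.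
    by rewrite mulr_ge0// exprn_even_ge0.
  rewrite deviation_wave ?k0 ?ltn_ord// dotZr exprMn ler_wpM2r ?sqr_ge0//.
  rewrite ler_sqr ?nnegrE ?sqr_ge0//.
  by rewrite cos2_pi_frac_le// k0 ltn_ord.
by apply: ler_sum => k _; rewrite mulrDr lerD.
Qed.

(** The bound is attained by mode 1 with phase 0, nonzero since its entry at
    vertex 0 is 1. *)
Lemma lambda_lazy_ring : lambda_mx W = cos (pi / n%:R) ^+ 2.
Proof.
apply: (@spectral_norm_eq _ _ _ (wave 1 0)).
- exact: sqr_ge0.
- have n0 : (0 < n)%N by lia.
  apply/eqP => /colP /(_ (Ordinal n0)); rewrite !mxE /= mulr0 mul0r mulr0 addr0 cos0.
  by move/eqP; rewrite oner_eq0.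
- by rewrite deviation_wave ?mulr1//; lia.
- exact: deviation_contracts.
Qed.

Lemma lambda_lazy_ring_lt1 : lambda_mx W < 1.
Proof.
by rewrite lambda_lazy_ring; have := @cos2_lt1 1; rewrite mulr1; apply; lia.
Qed.

Lemma tau_lazy_ring : tau_mx W = 1 / sin (pi / n%:R) ^+ 2.
Proof. by rewrite /tau_mx lambda_lazy_ring sin2cos2. Qed.

End Spectrum.

(** * Orders of growth *)

Section Theta.
Context {R : realType}.

Lemma eqTheta_of_bounds {T : Type} (F : filter_on T) (f g : T -> R^o) (a b : R) :
  0 < a -> 0 < b ->
  (\forall x \near F, 0 <= g x /\ a * g x <= f x <= b * g x) ->
  f =Theta_F g.
Proof.
move=> a0 b0 fg; rewrite eqThetaE bigThetaE eqOmegaO; split; apply/eqO_exP.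
  exists b => //; apply: filterS fg => n [g0 /andP[af fb]].
  by rewrite !ger0_norm// (le_trans _ af)// mulr_ge0// ltW.
exists a^-1; rewrite ?invr_gt0//; apply: filterS fg => n [g0 /andP[af fb]].
rewrite !ger0_norm//; first by rewrite ler_pdivlMl.
by rewrite (le_trans _ af)// mulr_ge0// ltW.
Qed.

(** The lower bound uses sin x <= x and the upper one
    sin x >= x cos x >= x cos (pi / 3), with x = pi / n <= pi / 3. *)
Lemma tau_lazy_ring_bounds n : (3 <= n)%N ->
  (pi ^+ 2)^-1 * n%:R ^+ 2 <= tau_mx (lazy_ring R n)
    <= ((pi * cos (pi / 3)) ^+ 2)^-1 * n%:R ^+ 2.
Proof.
move=> n3; rewrite tau_lazy_ring// div1r.
have pi0 := @pi_gt0 R.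
have n_gt0 : 0 < n%:R :> R by rewrite ltr0n; lia.
have n3R : 3 <= n%:R :> R by rewrite ler_nat.
set x : R := pi / n%:R.
have x_gt0 : 0 < x by rewrite divr_gt0.
have x3 : x <= pi / 3 by rewrite ler_pM2l// lef_pV2// posrE.
have c_gt0 : 0 < cos (pi / 3) :> R by apply: cos_gt0_pihalf; lra.
have lec : cos (pi / 3) <= cos x.
  rewrite leNgt ltr_cos ?in_itv /= -?leNgt//; lra.
have /andP[lo hi] : x * cos x <= sin x <= x by apply: sin_bounds; lra.
have s_gt0 : 0 < sin x.
  by apply: lt_le_trans lo; rewrite mulr_gt0// (lt_le_trans c_gt0).
rewrite -!exprVn -!exprMn.
have xV : x^-1 = pi^-1 * n%:R by rewrite invfM invrK.
have xcV : (x * cos (pi / 3))^-1 = (pi * cos (pi / 3))^-1 * n%:R.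
  by rewrite invfM xV invfM mulrAC.
clearbody x; rewrite -xV -xcV.
rewrite !ler_sqr ?nnegrE ?invr_ge0 ?mulr_ge0 ?(ltW s_gt0, ltW x_gt0, ltW c_gt0)//.
rewrite !lef_pV2 ?posrE ?mulr_gt0// hi andTb.
by apply: le_trans lo; rewrite ler_pM2l.
Qed.

(** For n >= 3, 2 (n / 2) <= n <= 3 (n / 2) with integer division; the worst case
    of the second inequality is n = 3. *)
Lemma diameter_ring_bounds n : (3 <= n)%N ->
  4 * (diameter (@ring_graph n))%:R ^+ 2 <= (n%:R ^+ 2 : R)
    <= 9 * (diameter (@ring_graph n))%:R ^+ 2.
Proof.
move=> n3; rewrite diameter_ring; last by lia.
by rewrite -!natrX -!natrM !ler_nat; nia.
Qed.

End Theta.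

Theorem lemma2p2 (R : realType) :
  (forall n : nat, (3 <= n)%N ->
    nonneg_mx (lazy_ring R n) /\
    lazy_ring R n \is symmetricmx /\
    doubly_stochastic (lazy_ring R n) /\
    pos_semidef (lazy_ring R n) /\
    support_graph (lazy_ring R n) =2 @ring_graph n /\
    diameter (@ring_graph n) = (n %/ 2)%N /\
    lambda_mx (lazy_ring R n) = cos (pi / n%:R) ^+ 2 /\
    lambda_mx (lazy_ring R n) < 1 /\
    tau_mx (lazy_ring R n) = 1 / sin (pi / n%:R) ^+ 2) /\
  (fun n : nat => tau_mx (lazy_ring R n) : R^o)
    =Theta_\oo (fun n : nat => n%:R ^+ 2 : R^o) /\
  (fun n : nat => tau_mx (lazy_ring R n) : R^o)
    =Theta_\oo (fun n : nat => (diameter (@ring_graph n))%:R ^+ 2 : R^o).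
Proof.
have pi0 := @pi_gt0 R.
have tau_n2 : (fun n : nat => tau_mx (lazy_ring R n) : R^o)
    =Theta_\oo (fun n : nat => n%:R ^+ 2 : R^o).
  apply: (@eqTheta_of_bounds _ _ _ _ _ (pi ^+ 2)^-1 ((pi * cos (pi / 3)) ^+ 2)^-1).
  - by rewrite invr_gt0 exprn_gt0.
  - rewrite invr_gt0 exprn_gt0// mulr_gt0//; apply: cos_gt0_pihalf; lra.
  - by exists 3 => // n /= n3; split; [exact: sqr_ge0 | exact: tau_lazy_ring_bounds].
split; [move=> n n3 | split=> //].
  split; first exact: lazy_ring_ge0.
  split; first exact: lazy_ring_sym.
  split.
    split; [exact: lazy_ring_ge0|exact: lazy_ring_row|exact: lazy_ring_col].
  split; first exact: lazy_ring_psd.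
  split; first exact: lazy_ring_support.
  split; first by apply: diameter_ring; lia.
  split; first exact: lambda_lazy_ring.
  by split; [exact: lambda_lazy_ring_lt1 | exact: tau_lazy_ring].
apply: (eqTheta_trans tau_n2); apply: (@eqTheta_of_bounds _ _ _ _ _ 4 9) => //.
by exists 3 => // n /= n3; split; [exact: sqr_ge0 | exact: diameter_ring_bounds].
Qed.
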